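(* Let $G=(V,E)$ be a graph of treewidth $t$, let $c:V\to\{\mathbf r,\mathbf b\}$ be a 2-colouring, and let $\mathcal H$ be a non-piercing family of subgraphs of $G$. Then $(G,\mathcal H)$ admits a primal support $Q$ with $\mathrm{tw}(Q)\le 2^{t+2}+t$.
   Context: All graphs are finite and simple. A subgraph $H$ of a graph $G$ is identified with its vertex set $V(H)$ (subgraphs are taken to be induced), and intersections, differences and containments of subgraphs refer to their vertex sets. A family $\mathcal H$ of subgraphs of $G$ is non-piercing if every $H\in\mathcal H$ induces a connected subgraph of $G$ and, for all $H,H'\in\mathcal H$, the induced subgraph $G[V(H)\setminus V(H')]$ is connected (an empty vertex set is regarded as connected). The 2-colouring $c$ need not be proper; $\mathbf b(V)=c^{-1}(\mathbf b)$ and $\mathbf b(H)=V(H)\cap\mathbf b(V)$. A primal support for $(G,\mathcal H)$ is a graph $Q$ with vertex set $\mathbf b(V)$ such that $Q[\mathbf b(H)]$ is connected for every $H\in\mathcal H$. $\mathrm{tw}$ denotes treewidth. *)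

(* Defs.v *)
From mathcomp Require Import all_boot.
Set Implicit Arguments.
Unset Strict Implicit.
Unset Printing Implicit Defensive.

Definition simple_graph (V : finType) (e : rel V) : Prop :=
  symmetric e /\ irreflexive e.

Definition induced (V : finType) (e : rel V) (S : {set V}) : rel V :=
  [rel x y | [&& x \in S, y \in S & e x y]].

(* G[S] is connected (the empty set counts as connected). *)
Definition connected_in (V : finType) (e : rel V) (S : {set V}) : Prop :=
  forall x y, x \in S -> y \in S -> connect (induced e S) x y.

Definition acyclic (I : finType) (f : rel I) : Prop :=
  forall c : seq I, uniq c -> 3 <= size c -> ~~ cycle f c.

Definition is_tree (I : finType) (f : rel I) : Prop :=
  [/\ simple_graph f, 0 < #|I|, connected_in f setT & acyclic f].

Definition tree_decomposition (V : finType) (e : rel V)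
  (I : finType) (f : rel I) (B : I -> {set V}) : Prop :=
  [/\ is_tree f,
      (forall v, exists i, v \in B i),
      (forall x y, e x y -> exists i, (x \in B i) && (y \in B i)) &
      (forall v, connected_in f [set i | v \in B i])].

Definition tw_le (V : finType) (e : rel V) (k : nat) : Prop :=
  exists (I : finType) (f : rel I) (B : I -> {set V}),
    tree_decomposition e f B /\ forall i, #|B i| <= k.+1.

Definition treewidth (V : finType) (e : rel V) (t : nat) : Prop :=
  tw_le e t /\ forall k, tw_le e k -> t <= k.

(* Non-piercing family of (vertex sets of induced) subgraphs. *)
Definition non_piercing (V : finType) (e : rel V) (F : {set {set V}}) : Prop :=
  forall H, H \in F ->
    connected_in e H /\ forall H', H' \in F -> connected_in e (H :\: H').

(* Colour b is encoded as [c v = true], colour r as [c v = false].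
   A primal support: a simple graph Q on b(V) = {v | c v} such that
   Q[b(H)] is connected for every H in F. *)
Definition primal_support (V : finType) (c : V -> bool) (F : {set {set V}})
  (Q : rel {v : V | c v}) : Prop :=
  simple_graph Q /\ forall H, H \in F -> connected_in Q [set x | val x \in H].

(* Main.v *)
Require Import Defs.
From mathcomp Require Import all_boot.

(* Take a tree decomposition of width [t] whose tree has maximum degree 3. An
   oriented tree edge [i -> j] splits V into the vertices beyond it, the adhesion
   A = B i /\ B j, and the vertices beyond [j -> i]. Call H crossing if it has blue
   vertices strictly on both sides but none in A. If K /\ A is contained in H, then
   non-piercing forces K \ H to lie on one side of the edge. Hence, whenever S is an
   inclusion-minimal trace on A of crossing sets, K is a lightest crossing set
   of trace S on the far side, and L is any crossing set of trace S, every crossing H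
   containing S contains every vertex of K beyond [i -> j] or every vertex of L beyond
   [j -> i]. So one blue "hub" per oriented edge and minimal trace suffices to meet
   all crossing sets; the minimal traces form an antichain, hence there are at most
   2^t of them. Weighing sets lexicographically, vertices close to the edge first,
   lets the hubs of [i -> j] be chosen among the blue vertices of B j and the hubs of
   the edges leaving j, so adding hubs to the bags keeps the bags of a vertex
   connected. Bags have at most t + 1 + 3 * 2^t blue vertices, and "sharing a bag" is
   the support. *)

Set Implicit Arguments.
Unset Strict Implicit.
Unset Printing Implicit Defensive.

(** * Sides of tree edges *)

Lemma connect_invariant (T : finType) (r : rel T) (P : T -> Prop) x y :
  (forall a b, r a b -> P a -> P b) -> connect r x y -> P x -> P y.
Proof.
move=> rP /connectP[p]; elim: p x => [|z p IHp] x /= => [_ -> //|].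
by case/andP=> /rP xz pz yE /xz; apply: IHp.
Qed.

Lemma induced_sym (T : finType) (r : rel T) (S : {set T}) :
  symmetric r -> symmetric (induced r S).
Proof. by move=> rS x y; rewrite /induced /= rS andbCA. Qed.

Section TreeSides.

Variables (I : finType) (f : rel I).
Hypothesis treef : is_tree f.

Let f_sym : symmetric f. Proof. by case: treef => -[]. Qed.

Lemma tree_edge_neq i j : f i j -> i != j.
Proof. by case: treef => -[_ fI] _ _ _ ij; apply: contraTneq ij => ->; rewrite fI. Qed.

(** For a tree edge, deleting the node [i] leaves around [j] the same component as deleting the
    edge. *)
Definition side (i j : I) : {set I} := [set k | connect (induced f [set~ i]) j k].

Lemma side_self i j : j \in side i j.
Proof. by rewrite inE. Qed.

Lemma side_step i j x y : x \in side i j -> f x y -> i != j -> y != i -> y \in side i j.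
Proof.
rewrite !inE => jx xy ij yi; apply: (connect_trans jx); apply: connect1.
rewrite /induced /= !inE xy yi !andbT; apply: contraTneq jx => -> {x xy}.
have Hc : connect_sym (induced f [set~ i]).
  exact/sym_connect_sym/induced_sym.
apply/negP; rewrite Hc => /connectP[[|z p]] /=; first by move=> _ E; rewrite E eqxx in ij.
by rewrite /induced /= !inE eqxx.
Qed.

Lemma side_notin i j : i != j -> i \notin side i j.
Proof.
move=> ij; rewrite inE; apply/negP => h.
have: j != i -> i != i.
  by apply: (connect_invariant (P := fun x => x != i)) h => a b /and3P[]; rewrite !inE.
by rewrite eqxx eq_sym => /(_ ij).
Qed.

Lemma side_ind i j (P : I -> Prop) :
  P j -> (forall x y, x != i -> y != i -> f x y -> P x -> P y) ->
  forall x, x \in side i j -> P x.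
Proof.
move=> Pj PS x; rewrite inE => jx; apply: connect_invariant jx Pj => a b.
by case/and3P; rewrite !inE => ai bi ab; apply: PS.
Qed.

(** Here acyclicity enters: a simple path from [k] to another neighbour [i] of [j] that avoids [j]
    would close up through [j] to a cycle. *)
Lemma side_neighbour i j k : f j i -> f j k -> i \in side j k -> i = k.
Proof.
case: treef => _ _ _ acyc ji jk; rewrite inE => /connectP[p0 pp0 lp0].
move: lp0 ji; have [p pp up _] := shortenP pp0 => -> {i p0 pp0} ji.
case: p => [|z p] in pp up ji *; first by [].
have pj : forall q x, path (induced f [set~ j]) x q -> path f x q /\ j \notin q.
  elim=> [|y q IHq] x //= /andP[/and3P[_]]; rewrite !inE eq_sym => yj xy /IHq[-> /negPf ->].
  by rewrite xy (negPf yj).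
have [pf jp] := pj _ _ pp.
have uc : uniq (j :: k :: z :: p).
  by rewrite cons_uniq up inE negb_or jp (tree_edge_neq jk).
have /negP[] := acyc _ uc isT.
by rewrite (cycle_path j) /= f_sym ji jk.
Qed.

Lemma side_sub i j k : f i j -> f j k -> k != i -> side j k \subset side i j.
Proof.
move=> ij jk ki; have iNj := tree_edge_neq ij.
have ji : f j i by rewrite f_sym.
apply/subsetP => x xjk.
suff : x \in side j k /\ x \in side i j by case.
move: x xjk; apply: side_ind.
  by split; [exact: side_self | exact: side_step (side_self _ _) jk iNj ki].
move=> x y xj yj xy [xjk xij].
have yjk : y \in side j k by apply: side_step xjk xy (tree_edge_neq jk) yj.
split=> //; apply: side_step xij xy iNj _; apply/negP => /eqP E.
by rewrite E in yjk; move: ki; rewrite (side_neighbour ji jk yjk) eqxx.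
Qed.

Lemma side_proper i j k : f i j -> f j k -> k != i -> side j k \proper side i j.
Proof.
move=> ij jk ki; apply/properP; split; first exact: side_sub.
by exists j; [exact: side_self | exact/side_notin/tree_edge_neq].
Qed.

Lemma side_cover j x : x != j -> exists2 k, f j k & x \in side j k.
Proof.
case: treef => _ _ conn _.
have /(connect_invariant (P := fun x => x = j \/ exists2 k, f j k & x \in side j k)) H :=
  conn j x (in_setT _) (in_setT _).
move/eqP=> xj; case: H => //; last by left.
move=> a b /and3P[_ _ ab]; have [->|bj] := eqVneq b j; first by left.
case=> [E|[k jk ak]]; right; first by exists b; [rewrite -E | exact: side_self].
by exists k => //; apply: side_step ak ab (tree_edge_neq jk) bj.
Qed.

Lemma side_uniq j k k' x : f j k -> f j k' -> x \in side j k -> x \in side j k' -> k = k'.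
Proof.
move=> jk jk' xk xk'; apply: (side_neighbour jk jk'); rewrite !inE in xk xk' *.
apply: connect_trans xk' _; rewrite (sym_connect_sym (induced_sym _ f_sym)).
by [].
Qed.

Lemma side_disjoint i j x : f i j -> x \in side i j -> x \in side j i -> False.
Proof.
move=> ij xij xji; have ji : f j i by rewrite f_sym.
have xi : x != i by apply: contraTneq xij => ->; exact/side_notin/tree_edge_neq.
have xj : x != j by apply: contraTneq xji => ->; exact/side_notin/tree_edge_neq.
have : x = j \/ exists2 k, f j k /\ k != i & x \in side j k.
  move: x xij {xji xi xj}; apply: side_ind; first by left.
  move=> a b ai bi ab H; have [->|bj] := eqVneq b j; first by left.
  right; case: H => [E|[k [jk ki] ak]].
    by exists b; [rewrite -E | exact: side_self].
  by exists k => //; apply: side_step ak ab (tree_edge_neq jk) bj.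
case=> [E|[k [jk ki] xk]]; first by rewrite E eqxx in xj.
by move: ki; rewrite (side_uniq jk ji xk xji) eqxx.
Qed.

(** Recursion away from an edge: the sides of the edges [j -> k] with [k != i] are strictly smaller
    than that of [i -> j]. A predicate [good] replaces a recursion function because the values will
    only be known to exist. *)
Lemma edge_recursion (X : Type) (x0 : X) (good : (I -> I -> X) -> I -> I -> X -> Prop) :
    (forall g g' i j x, (forall k, f j k -> k != i -> g j k = g' j k) ->
       good g i j x -> good g' i j x) ->
    (forall g i j, f i j -> (forall k, f j k -> k != i -> good g j k (g j k)) ->
       exists x, good g i j x) ->
  exists g, forall i j, f i j -> good g i j (g i j).
Proof.
move=> good_ext good_step.
suff /(_ #|I|.+1)[g Hg] : forall n, exists g, forall i j,
    f i j -> #|side i j| < n -> good g i j (g i j).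
  by exists g => i j ij; apply: Hg => //; rewrite ltnS max_card.
elim=> [|n [g Hg]]; first by exists (fun _ _ => x0).
have lt_side i j k : f i j -> f j k -> k != i -> #|side j k| < #|side i j|.
  by move=> ij jk ki; apply/proper_card/side_proper.
have /fin_all_exists[h Hh] (p : I * I) :
    exists x, f p.1 p.2 -> #|side p.1 p.2| = n -> good g p.1 p.2 x.
  case: p => i j /=.
  have [/andP[ij /eqP En]|N] := boolP (f i j && (#|side i j| == n)).
    have [|x gx] := good_step g i j ij; last by exists x.
    by move=> k jk ki; apply: Hg => //; rewrite -En lt_side.
  by exists x0 => ij En; rewrite ij En eqxx in N.
(* Only edges whose side has exactly [n] nodes get a new value; the values that their condition
   reads belong to smaller sides and stay unchanged. *)
exists (fun i j => if #|side i j| == n then h (i, j) else g i j) => i j ij.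
have agree : #|side i j| <= n -> forall k, f j k -> k != i ->
    g j k = if #|side j k| == n then h (j, k) else g j k.
  move=> le_n k jk ki; rewrite ifN //.
  by rewrite neq_ltn (leq_trans (lt_side _ _ _ ij jk ki)).
rewrite ltnS => le_n; apply: good_ext (agree le_n) _.
case: eqP => [En|/eqP ne]; first exact: (Hh (i, j)).
by apply: Hg => //; rewrite ltn_neqAle ne.
Qed.

End TreeSides.

(** * Vertices beyond a tree edge *)

Section Beyond.

Variables (V : finType) (e : rel V) (I : finType) (f : rel I) (B : I -> {set V}).
Hypothesis decB : tree_decomposition e f B.

Let treef : is_tree f. Proof. by case: decB. Qed.
Let f_sym : symmetric f. Proof. by case: treef => -[]. Qed.

Definition beyond (i j : I) : {set V} :=
  [set v | (v \notin B i) && [exists k in side f i j, v \in B k]].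

Lemma beyond_notin i j v : v \in beyond i j -> v \notin B i.
Proof. by rewrite inE => /andP[]. Qed.

(** The nodes whose bags contain [v] form a connected part of the tree that avoids [i], so they
    cannot leave the side of [j]. *)
Lemma beyond_bags i j v k : f i j -> v \in beyond i j -> v \in B k -> k \in side f i j.
Proof.
case: decB => _ _ _ conn ij; rewrite inE => /andP[vi /'exists_andP[l [lij vl]]] vk.
have lk := conn v l k; rewrite !inE in lk.
apply: (connect_invariant (P := fun x => x \in side f i j)) (lk vl vk) lij => a b /and3P[_].
rewrite inE => vb ab aij.
apply: (side_step treef) aij ab (tree_edge_neq treef ij) _.
by apply: contraNneq vi => <-.
Qed.

Lemma beyond_cover j v : v \notin B j -> exists2 k, f j k & v \in beyond j k.
Proof.
case: decB => _ cov _ _ vj; have [l vl] := cov v.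
have lj : l != j by apply: contraNneq vj => <-.
have [k jk lk] := side_cover treef lj; exists k => //.
by rewrite inE vj; apply/'exists_andP; exists l.
Qed.

Lemma beyond_uniq j k k' v :
  f j k -> f j k' -> v \in beyond j k -> v \in beyond j k' -> k = k'.
Proof.
case: decB => _ cov _ _ jk jk' vk vk'; have [l vl] := cov v.
exact (side_uniq treef jk jk' (beyond_bags jk vk vl) (beyond_bags jk' vk' vl)).
Qed.

Lemma beyond_disjoint i j v : f i j -> v \in beyond i j -> v \in beyond j i -> False.
Proof.
case: decB => _ cov _ _ ij vij vji; have [l vl] := cov v.
have ji : f j i by rewrite f_sym.
exact (side_disjoint treef ij (beyond_bags ij vij vl) (beyond_bags ji vji vl)).
Qed.

Lemma beyond_edge i j x y : f i j -> e x y -> x \in beyond i j -> y \in beyond j i -> False.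
Proof.
case: decB => _ _ edge _ ij /edge[k /andP[xk yk]] xij yji.
have ji : f j i by rewrite f_sym.
exact (side_disjoint treef ij (beyond_bags ij xij xk) (beyond_bags ji yji yk)).
Qed.

Lemma beyond_total i j v : f i j ->
  [\/ v \in B i :&: B j, v \in beyond i j | v \in beyond j i].
Proof.
move=> ij; have ji : f j i by rewrite f_sym.
rewrite in_setI; have [vi|vi] := boolP (v \in B i); have [vj|vj] := boolP (v \in B j).
- by constructor 1.
- constructor 3; rewrite inE vj; apply/'exists_andP; exists i; split=> //.
  exact: side_self.
- constructor 2; rewrite inE vi; apply/'exists_andP; exists j; split=> //.
  exact: side_self.
have [k jk vk] := beyond_cover vj.
have [ki|ki] := eqVneq k i; first by constructor 3; rewrite -ki.
constructor 2; rewrite inE vi; move: vk; rewrite inE vj => /'exists_andP[l [lk vl]].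
apply/'exists_andP; exists l; split=> //.
exact: subsetP (side_sub treef ij jk ki) _ lk.
Qed.

Lemma beyond_sub i j k v : f i j -> f j k -> k != i -> v \in beyond j k -> v \in beyond i j.
Proof.
move=> ij jk ki vk; have ji : f j i by rewrite f_sym.
case: (beyond_total v ij) => // [|vji].
  by rewrite in_setI (negPf (beyond_notin vk)) andbF.
by move: ki; rewrite (beyond_uniq jk ji vk vji) eqxx.
Qed.

Lemma beyond_back j k k' v : f j k -> f j k' -> k != k' ->
  v \in beyond j k -> v \in beyond k' j.
Proof.
by move=> jk jk' kk'; apply: beyond_sub; rewrite // f_sym.
Qed.

Lemma bag_beyond i j v : f i j -> v \in B j -> v \notin B i -> v \in beyond i j.
Proof.
move=> ij vj vi; case: (beyond_total v ij) => //.
  by rewrite in_setI (negPf vi).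
by move/beyond_notin; rewrite vj.
Qed.

End Beyond.

Lemma edge_ind (I : finType) (f : rel I) (P : I -> I -> Prop) : is_tree f ->
    (forall i j, f i j -> (forall k, f j k -> k != i -> P j k) -> P i j) ->
  forall i j, f i j -> P i j.
Proof.
move=> treef step; pose good (g : I -> I -> unit) i j (x : unit) := P i j.
have [|g i j ij /(step i j ij) Pij|_ //] := edge_recursion treef tt (good := good) _ _.
  by [].
by exists tt.
Qed.

(** * Inclusion on a vertex set, and antichains *)

Section SubsetOn.

Variable V : finType.
Implicit Types D H K L : {set V}.

Definition sub_on D K H := K :&: D \subset H.

Lemma sub_onP D K H : reflect (forall v, v \in D -> v \in K -> v \in H) (sub_on D K H).
Proof.
apply: (iffP subsetP) => KH v; first by move=> vD vK; apply: KH; rewrite inE vK.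
by rewrite inE => /andP[vK vD]; apply: KH.
Qed.

Lemma sub_onPn D K H : reflect (exists v, [/\ v \in D, v \in K & v \notin H]) (~~ sub_on D K H).
Proof.
apply: (iffP subsetPn) => [[v]|[v [vD vK vH]]].
  by rewrite inE => /andP[vK vD] vH; exists v.
by exists v; rewrite // inE vK.
Qed.

End SubsetOn.

(** Deleting a fixed [u] is injective on an antichain, since two sets that differ only in [u] are
    comparable. This is weaker than Sperner's bound but gives [2 ^ t] for adhesions of at most
    [t + 1] vertices. *)
Lemma card_antichain (T : finType) (A : {set T}) (M : {set {set T}}) :
    A != set0 -> (forall S, S \in M -> S \subset A) ->
    (forall S S', S \in M -> S' \in M -> S \subset S' -> S = S') ->
  #|M| <= 2 ^ #|A|.-1.
Proof.
case/set0Pn=> u uA subA anti.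
have inj : {in M &, injective (fun S : {set T} => S :\ u)}.
  move=> S S' SM S'M E; have [uS|uS] := boolP (u \in S).
    by apply/esym/anti => //; rewrite -(setD1K uS) E -subDset.
  apply: anti => //; apply/subsetP => v vS.
  have: v \in S :\ u by rewrite !inE vS andbT; apply: contraNneq uS => <-.
  by rewrite E !inE => /andP[].
rewrite -(card_in_imset inj) (cardsD1 u A) uA /= -card_powerset.
apply/subset_leq_card/subsetP => _ /imsetP[S /subA SA ->].
by rewrite inE setSD.
Qed.

(** * Lexicographic weights *)

Section LexicographicWeight.

Variables (V : finType) (e : rel V) (I : finType) (f : rel I) (B : I -> {set V}).
Hypothesis decB : tree_decomposition e f B.

Let treef : is_tree f. Proof. by case: decB. Qed.

Local Notation D := (beyond f B).

(** What is used of the lexicographic order: growth beyond the edge adds weight; growth in the first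
    layer [B j :\: B i] outweighs everything further out; a change confined to one branch [j -> k]
    is judged by the weight of that branch. *)
Definition lex_weight (m : I -> I -> {set V} -> nat) : Prop :=
  forall i j, f i j -> forall H K : {set V},
  [/\ sub_on (D i j) H K -> ~~ sub_on (D i j) K H -> m i j H < m i j K,
      sub_on (B j :\: B i) H K -> ~~ sub_on (B j :\: B i) K H -> m i j H < m i j K &
      forall k, f j k -> k != i -> H :\: D j k = K :\: D j k ->
        m j k H <= m j k K -> m i j H <= m i j K].

(** The leading digit counts the vertices in the first layer, and its base [top] exceeds every
    possible total of the branches. *)
Lemma lex_weight_exists : exists m, lex_weight m.
Proof.
pose rest (g : I -> I -> {set V} -> nat) i j K := \sum_(k | f j k && (k != i)) g j k K.
pose top (g : I -> I -> {set V} -> nat) i j := (\max_(K : {set V}) rest g i j K).+1.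
pose good (g : I -> I -> {set V} -> nat) i j (x : {set V} -> nat) :=
  forall K, x K = #|K :&: (B j :\: B i)| * top g i j + rest g i j K.
have [|g i j ij _|m mE] :=
    edge_recursion treef (fun _ => 0) (good := good) _ _.
- move=> g g' i j x gg' Hx K; rewrite Hx.
  have E L : rest g i j L = rest g' i j L.
    by apply: eq_bigr => k /andP[jk ki]; rewrite gg'.
  by rewrite E /top; under eq_bigr do rewrite E.
- by exists (fun K => #|K :&: (B j :\: B i)| * top g i j + rest g i j K).
have top_gt i j K : rest m i j K < top m i j by rewrite ltnS leq_bigmax.
have card_le (L H K : {set V}) : sub_on L H K -> #|H :&: L| <= #|K :&: L|.
  by move=> HK; apply: subset_leq_card; rewrite subsetI subsetIr andbT.
have card_lt (L H K : {set V}) : sub_on L H K -> ~~ sub_on L K H -> #|H :&: L| < #|K :&: L|.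
  move=> HK KH; apply: proper_card; rewrite properE !subsetI !subsetIr !andbT.
  exact/andP.
have layer i j v : f i j -> v \in B j :\: B i -> v \in D i j.
  by move=> ij; rewrite inE => /andP[vi vj]; apply: (bag_beyond decB).
have mono i j : f i j -> forall H K, sub_on (D i j) H K -> m i j H <= m i j K.
  move: i j; apply: (edge_ind treef) => i j ij IH H K /sub_onP HK.
  rewrite !mE //; apply: leq_add.
    by rewrite leq_mul2r card_le ?orbT //; apply/sub_onP => v /(layer i j v ij); apply: HK.
  apply: leq_sum => k /andP[jk ki]; apply: IH => //; apply/sub_onP => v vk.
  by apply: HK; apply: (beyond_sub decB) jk ki vk.
have lead i j : f i j -> forall H K,
    #|H :&: (B j :\: B i)| < #|K :&: (B j :\: B i)| -> m i j H < m i j K.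
  move=> ij H K lt; rewrite !mE //.
  apply: leq_trans (leq_addr _ _); apply: leq_trans (leq_mul lt (leqnn _)).
  by rewrite mulSn addnC ltn_add2r.
have strict i j : f i j -> forall H K,
    sub_on (D i j) H K -> ~~ sub_on (D i j) K H -> m i j H < m i j K.
  move: i j; apply: (edge_ind treef) => i j ij IH H K HK /sub_onPn[v [vij vK vH]].
  have HKl : sub_on (B j :\: B i) H K.
    by apply/sub_onP => w /(layer i j w ij); apply/sub_onP.
  have [vj|vj] := boolP (v \in B j).
    apply/lead/card_lt => //; apply/sub_onPn; exists v.
    by rewrite inE vj (beyond_notin vij).
  have [k jk vk] := beyond_cover decB vj.
  have ki : k != i.
    by apply/negP => /eqP E; rewrite E in vk; apply: (beyond_disjoint decB ij vij vk).
  have HKk k' : f j k' -> k' != i -> sub_on (D j k') H K.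
    move=> jk' k'i; apply/sub_onP => w wk'; move/sub_onP: HK; apply.
    exact: (beyond_sub decB) jk' k'i wk'.
  rewrite !mE // -addnS; apply: leq_add.
    by rewrite leq_mul2r card_le ?orbT.
  (* The branch containing [v] gains strictly, the others weakly. *)
  rewrite /rest (bigD1 k) ?jk //= [in leqRHS](bigD1 k) ?jk //= -addSn.
  apply: leq_add; first by apply: IH => //; [exact: HKk | apply/sub_onPn; exists v].
  by apply: leq_sum => k' /andP[/andP[jk' k'i] _]; apply: mono => //; apply: HKk.
exists m => i j ij H K; split; first exact: strict.
  by move=> HK KH; apply: lead => //; apply: card_lt.
move=> k jk ki HKE mk; have HKv v : v \notin D j k -> (v \in H) = (v \in K).
  by move=> vk; have /setP/(_ v) := HKE; rewrite !in_setD vk.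
rewrite !mE //; apply: leq_add.
  rewrite leq_mul2r card_le ?orbT //; apply/sub_onP => v.
  rewrite inE => /andP[_ vj]; rewrite HKv //.
  by apply/negP => /beyond_notin; rewrite vj.
apply: leq_sum => k' /andP[jk' k'i]; have [->//|k'k] := eqVneq k' k.
apply: mono => //; apply/sub_onP => v vk'; rewrite HKv //.
by apply/negP => vk; move: k'k; rewrite (beyond_uniq decB jk' jk vk' vk) eqxx.
Qed.

End LexicographicWeight.

(** * Subcubic tree decompositions *)

(** [h] is the distance to [r], and [par i] begins a shortest path. Every edge arises from [par]:
    seen from an end [i] that is at least as high as the other, both the other end and [par i] lead
    towards [r], and only one neighbour does. *)
Lemma tree_parent (I : finType) (f : rel I) (r : I) : is_tree f ->
  exists (par : I -> I) (h : I -> nat),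
    (forall i, i != r -> h (par i) < h i) /\
    (forall i j, f i j -> (i != r /\ par i = j) \/ (j != r /\ par j = i)).
Proof.
move=> treef; have [[f_sym f_irr] _ conn _] := treef.
pose reach i n := [exists p : n.-tuple I, path f i p && (last i p == r)].
have reachP i n : reflect (exists p, [/\ size p = n, path f i p & last i p = r]) (reach i n).
  apply: (iffP existsP) => [[p /andP[pp /eqP lp]]|[p [sp pp lp]]].
    by exists p; rewrite size_tuple.
  by exists (Tuple (introT eqP sp)); rewrite /= pp lp eqxx.
have ex_reach i : exists n, reach i n.
  have /connectP[p pp lp] := conn i r (in_setT _) (in_setT _).
  exists (size p); apply/reachP; exists p; split=> //.
  by apply: sub_path pp => a b /and3P[].
pose h i := ex_minn (ex_reach i).
have hr : h r = 0.
  rewrite /h; case: ex_minnP => n _ /(_ 0) min; apply/eqP; rewrite -leqn0; apply: min.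
  by apply/reachP; exists [::].
have /fin_all_exists[par parP] i : exists j, i != r -> f i j /\ h j < h i.
  have [->|ir] := eqVneq i r; first by exists r.
  rewrite /h; case: ex_minnP => n /reachP[[|j p] [/= sp pp lp]] _.
    by rewrite lp eqxx in ir.
  case/andP: pp => ij pp; exists j; split=> //; case: ex_minnP => k _ /(_ (size p)) min.
  by rewrite -sp ltnS; apply: min; apply/reachP; exists p.
(* The successive parents of [j] are strictly lower than [i], so the way from [j] to the root avoids
   [i]. *)
have climb i : i != r -> forall n j, h j < n -> j != i -> h j <= h i -> r \in side f i j.
  move=> ir; elim=> // n IHn j; rewrite ltnS => jn ji hji.
  have [->|jr] := eqVneq j r; first exact: side_self.
  have [fjp hjp] := parP j jr.
  have pi : par j != i by apply: contraTneq (leq_trans hjp hji) => ->; rewrite ltnn.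
  have := IHn (par j) (leq_trans hjp jn) pi (ltnW (leq_trans hjp hji)).
  rewrite !in_set; apply: connect_trans; apply: connect1.
  by rewrite /induced /= !inE ji pi.
have up i j : f i j -> h j <= h i -> i != r /\ par i = j.
  move=> ij hji; have ji : j != i by apply: contraTneq ij => ->; rewrite f_irr.
  have ir : i != r.
    apply/eqP => E; rewrite E hr leqn0 in hji ji.
    by have [_] := parP j ji; rewrite (eqP hji).
  split=> //; have [fip hip] := parP i ir.
  have pi : par i != i by apply: contraTneq hip => ->; rewrite ltnn.
  apply: (side_uniq treef fip ij (x := r)); first exact: climb (ltnSn _) pi (ltnW hip).
  exact: climb (ltnSn _) ji hji.
exists par, h; split=> [i /parP[] //|i j ij].
by have [/up|/ltnW/up] := leqP (h j) (h i); [left; auto | rewrite f_sym; right; auto].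
Qed.

(** * Trees given by a parent function *)

Section ParentTree.

Variables (J : finType) (r : J) (par : J -> J) (h : J -> nat).
Hypothesis h_par : forall x, x != r -> h (par x) < h x.

Definition parent_rel : rel J :=
  [rel x y | (x != r) && (par x == y) || (y != r) && (par y == x)].

Lemma parent_rel_sym : symmetric parent_rel.
Proof. by move=> x y; rewrite /parent_rel /= orbC. Qed.

Lemma parent_rel_up x y : parent_rel x y -> h y <= h x -> y = par x.
Proof.
case/orP=> /andP[nr /eqP <-] //; rewrite leqNgt.
by rewrite h_par.
Qed.

(** Heights fall along [par], so every node is joined to [r]. On a cycle, both neighbours of a
    highest node would be its parent. *)
Lemma parent_rel_tree : is_tree parent_rel.
Proof.
have csym := sym_connect_sym (induced_sym [set: J] parent_rel_sym).
have irr : irreflexive parent_rel.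
  move=> x; rewrite /parent_rel /= orbb; apply/negP => /andP[/h_par + /eqP E].
  by rewrite E ltnn.
split.
- by split; [exact: parent_rel_sym | exact: irr].
- by apply/card_gt0P; exists r.
- have to_r : forall n x, h x < n -> connect (induced parent_rel setT) x r.
    elim=> // n IHn x; rewrite ltnS => xn; have [->//|xr] := eqVneq x r.
    have hp := h_par xr; apply: connect_trans (IHn (par x) (leq_trans hp xn)).
    by apply: connect1; rewrite /induced /parent_rel /= !inE xr eqxx.
  move=> x y _ _; apply: connect_trans (to_r _ x (ltnSn _)) _.
  by rewrite csym (to_r _ y (ltnSn _)).
move=> c uc sc; apply/negP => cc.
have [x0 x0c] : exists x0, x0 \in c by case: (c) sc => // x s; exists x; rewrite mem_head.
have [x xc xmax] := arg_maxnP h x0c.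
have [n s sE] := rot_to xc.
have mem_s y : y \in s -> y \in c by move=> ys; rewrite -(mem_rot n) sE inE ys orbT.
rewrite -(rot_uniq n) sE /= in uc; rewrite -(rot_cycle n) sE in cc.
rewrite -(size_rot n) sE in sc; case: s => [|y s] // in sE mem_s uc cc sc.
case/lastP: s => [|s z] // in sE mem_s uc cc sc.
move: cc; rewrite (cycle_path x) /= last_rcons => /and3P[zx xy _].
rewrite parent_rel_sym in zx.
have ys : y \in y :: rcons s z by rewrite mem_head.
have zs : z \in y :: rcons s z by rewrite inE mem_rcons mem_head orbT.
have yE := parent_rel_up xy (xmax y (mem_s y ys)).
have zE := parent_rel_up zx (xmax z (mem_s z zs)).
by move: uc; rewrite yE zE /= mem_rcons mem_head andbF.
Qed.

End ParentTree.

(* Every node is replaced by a path of copies, and the edge to its [k]-th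
   potential child leaves from the [k]-th copy. *)
Lemma subcubic_decomposition (V : finType) (e : rel V) (I : finType) (f : rel I)
    (B : I -> {set V}) : tree_decomposition e f B ->
  exists (J : finType) (f' : rel J) (p : J -> I),
    tree_decomposition e f' (B \o p) /\ forall x, #|[set y | f' x y]| <= 3.
Proof.
case=> treef cov edge conn; have [_ /card_gt0P[r _] _ _] := treef.
have [par [h [h_par f_par]]] := tree_parent r treef.
pose J := (I * 'I_#|I|.+1)%type.
pose par' (x : J) : J :=
  if x.2 == ord0 then (par x.1, inord (enum_rank x.1)) else (x.1, inord x.2.-1).
(* Lexicographic height: all copies of [par i] are lower than all copies of [i], and copies of one
   node are ordered by index. *)
pose h' (x : J) := h x.1 * #|I|.+1 + x.2.
pose r' : J := (r, ord0).
have rank_lt (i : I) : enum_rank i < #|I|.+1 by exact: leqW (ltn_ord (enum_rank i)).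
have pred_lt (k : 'I_#|I|.+1) : k.-1 < #|I|.+1 by apply: leq_ltn_trans (leq_pred _) _.
have h_par' x : x != r' -> h' (par' x) < h' x.
  case: x => i k; rewrite /par' /h' /=; case: (k =P ord0) => [->|/eqP k0] /=.
    rewrite xpair_eqE eqxx andbT => /h_par lt.
    rewrite inordK // addn0; apply: leq_trans (leq_mul lt (leqnn _)).
    by rewrite mulSn addnC ltn_add2r.
  by move=> _; rewrite inordK // ltn_add2l prednK // lt0n.
pose f' := parent_rel r' par'.
have par_edge x : x != r' -> f' x (par' x).
  by move=> xr; rewrite /f' /parent_rel /= xr eqxx.
exists J, f', fst; split; last first.
  (* The possible neighbours are the parent, the next copy of the same node, and the first copy of
     the node of rank [k]. The default [r] covers the last index, which is no rank. *)
  case=> i k; pose s := [:: par' (i, k); (i, inord k.+1); (nth r (enum I) k, ord0)].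
  apply: leq_trans (card_size s); apply/subset_leq_card/subsetP => -[j l].
  rewrite /s inE /f' /parent_rel /= => /orP[/andP[_ /eqP <-]|/andP[_]].
    by rewrite mem_head.
  rewrite {1}/par' /=; case: (l =P ord0) => [->|/eqP l0];
    rewrite xpair_eqE => /andP[/eqP <- /eqP <-].
    by rewrite !inE inordK // nth_enum_rank eqxx !orbT.
  have lE : l = inord (inord l.-1 : 'I_#|I|.+1).+1 :> 'I_#|I|.+1.
    by apply: val_inj; rewrite /= (inordK (pred_lt l)) prednK ?lt0n // inordK.
  by rewrite !inE -lE eqxx !orbT.
split.
- exact: parent_rel_tree h_par'.
- by move=> v; have [i vi] := cov v; exists (i, ord0).
- by move=> x y /edge[i xyi]; exists (i, ord0).
move=> v; set T := [set x | _]; have inT x : (x \in T) = (v \in B x.1) by rewrite inE.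
have f'_sym : symmetric f' by exact: parent_rel_sym.
have csym := sym_connect_sym (induced_sym T f'_sym).
have chain i (k : 'I_#|I|.+1) : v \in B i -> connect (induced f' T) (i, k) (i, ord0).
  move=> vi; case: k => n; elim: n => [|n IHn] lt_n.
    by rewrite (_ : Ordinal lt_n = ord0) //; apply: val_inj.
  apply: connect_trans (IHn (ltnW lt_n)); apply: connect1.
  apply/and3P; rewrite !inT; split=> //.
  have -> : (i, Ordinal (ltnW lt_n)) = par' (i, Ordinal lt_n).
    by rewrite /par' /=; congr pair; apply: val_inj; rewrite /= inordK // ltnW.
  by apply: par_edge; rewrite xpair_eqE andbC.
have climb i : i != r -> v \in B i -> v \in B (par i) ->
    connect (induced f' T) (i, ord0) (par i, ord0).
  move=> ir vi vp; apply: connect_trans (chain (par i) (inord (enum_rank i)) vp).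
  apply: connect1; apply/and3P; rewrite !inT; split=> //.
  have -> : (par i, inord (enum_rank i)) = par' (i, ord0) by rewrite /par' eqxx.
  by apply: par_edge; rewrite xpair_eqE (negPf ir).
move=> [i k] [j l]; rewrite !inT /= => vi vj.
apply: connect_trans (chain i k vi) _; rewrite csym.
apply: connect_trans (chain j l vj) _.
have := conn v j i; rewrite !inE => /(_ vj vi).
move/(connect_invariant (P := fun a => connect (induced f' T) (j, ord0) (a, ord0))).
apply=> // a b /and3P[]; rewrite !inE => va vb ab; move/connect_trans; apply.
case: (f_par a b ab) => -[nr E]; rewrite -E in va vb *; first exact: climb.
by rewrite csym; apply: climb.
Qed.

(** * Hubs *)

Section Hubs.

Variables (V : finType) (e : rel V) (I : finType) (f : rel I) (B : I -> {set V}).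
Variables (c : V -> bool) (F : {set {set V}}) (t : nat).
Hypothesis decB : tree_decomposition e f B.
Hypothesis npF : non_piercing e F.
Hypothesis cardB : forall i, #|B i| <= t.+1.

Let treef : is_tree f. Proof. by case: decB. Qed.
Let f_sym : symmetric f. Proof. by case: treef => -[]. Qed.

Local Notation D := (beyond f B).
Local Notation adh i j := (B i :&: B j).

Implicit Types H K L S X : {set V}.

Definition blue_on H X := [exists v in H :&: X, c v].

Lemma blue_onP H X : reflect (exists v, [/\ v \in H, v \in X & c v]) (blue_on H X).
Proof.
apply: (iffP 'exists_andP) => [[v]|[v [vH vX cv]]].
  by rewrite in_setI => -[/andP[vH vX] cv]; exists v.
by exists v; rewrite in_setI vH.
Qed.

Lemma blue_onPn H X v : ~~ blue_on H X -> v \in H -> v \in X -> c v = false.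
Proof. by move=> /blue_onP N vH vX; apply/negP => cv; case: N; exists v. Qed.

(** These sets need a hub: no blue vertex of the adhesion links their two blue parts. *)
Definition crossing i j : {set {set V}} :=
  [set H in F | [&& blue_on H (D i j), blue_on H (D j i) & ~~ blue_on H (adh i j)]].

Lemma crossingP i j H :
  reflect [/\ H \in F, blue_on H (D i j), blue_on H (D j i) & ~~ blue_on H (adh i j)]
          (H \in crossing i j).
Proof. by rewrite in_set; apply: and4P. Qed.

Lemma crossingC i j : crossing i j = crossing j i.
Proof.
apply/setP => H; apply/crossingP/crossingP => -[HF b1 b2 b3]; split=> //.
  by rewrite setIC.
by rewrite setIC.
Qed.

Lemma connected_separated i j (X : {set V}) x y :
    f i j -> connected_in e X -> (forall v, v \in X -> v \notin adh i j) ->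
    x \in X -> y \in X -> x \in D i j -> y \in D j i -> False.
Proof.
move=> ij conn Xadh xX yX xij yji.
suff yij : y \in D i j by apply: (beyond_disjoint decB ij yij yji).
apply: (connect_invariant (P := fun v => v \in D i j)) (conn x y xX yX) xij => a b.
case/and3P=> _ bX ab aij; case: (beyond_total decB b ij) => //.
  by move=> badh; move: (Xadh b bX); rewrite badh.
by move=> bji; case: (beyond_edge decB ij ab aij bji).
Qed.

(** By non-piercing, [K :\: H] is connected. It avoids the adhesion, so it misses one of the two
    sides. *)
Lemma one_sided i j H K : f i j -> H \in F -> K \in F -> sub_on (adh i j) K H ->
  sub_on (D i j) K H \/ sub_on (D j i) K H.
Proof.
move=> ij HF KF /sub_onP KH.
case: (boolP (sub_on (D i j) K H)) => [|/sub_onPn[x [xij xK xH]]]; first by left.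
case: (boolP (sub_on (D j i) K H)) => [|/sub_onPn[y [yji yK yH]]]; first by right.
have [_ /(_ H HF) conn] := npF KF.
case: (@connected_separated i j (K :\: H) x y) => //; rewrite ?in_setD ?xH ?yH //.
by move=> v; rewrite in_setD => /andP[vH vK]; apply: contra vH => /KH; apply.
Qed.

Definition min_traces i j : {set {set V}} :=
  [set S | minset (fun S => S \in [set H :&: adh i j | H in crossing i j]) S].

Lemma min_tracesC i j : min_traces i j = min_traces j i.
Proof. by rewrite /min_traces crossingC setIC. Qed.

Lemma min_traces_exists i j H : H \in crossing i j ->
  exists2 S, S \in min_traces i j & S \subset H.
Proof.
move=> HX; have HT : H :&: adh i j \in [set H :&: adh i j | H in crossing i j].
  exact: imset_f.
have [S minS SH] := minset_exists (P := fun S => S \in _) HT.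
exists S; first by rewrite in_set.
exact: subset_trans SH (subsetIl _ _).
Qed.

Lemma min_traces_crossing i j S : S \in min_traces i j ->
  exists2 H, H \in crossing i j & H :&: adh i j = S.
Proof.
by rewrite in_set => /minsetP[/imsetP[H HX ->] _]; exists H.
Qed.

Lemma min_traces_min i j S H : S \in min_traces i j -> H \in crossing i j ->
  H :&: adh i j \subset S -> H :&: adh i j = S.
Proof.
rewrite in_set => /minsetP[_ minS] HX; apply: minS.
exact: imset_f.
Qed.

(** A connected set cannot cross an empty adhesion. Otherwise minimality makes the traces an
    antichain in a set of at most [t + 1] vertices. *)
Lemma card_min_traces i j : f i j -> #|min_traces i j| <= 2 ^ t.
Proof.
move=> ij; have [A0|A0] := eqVneq (adh i j) set0.
  rewrite (_ : min_traces i j = set0) ?cards0 //; apply/setP => S; rewrite in_set0.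
  apply/negP => /min_traces_crossing[H /crossingP[HF]] /blue_onP[x [xH xij _]].
  move=> /blue_onP[y [yH yji _]] _ _; have [conn _] := npF HF.
  by case: (connected_separated ij conn _ xH yH xij yji) => v _; rewrite A0 in_set0.
have leA : #|adh i j|.-1 <= t.
  rewrite -ltnS prednK ?card_gt0 //.
  by apply: leq_trans (cardB i); apply/subset_leq_card/subsetIl.
apply: leq_trans (leq_pexp2l _ leA) => //; apply: card_antichain => //.
  by move=> S /min_traces_crossing[H _ <-]; apply: subsetIr.
move=> S S' /min_traces_crossing[H HX <-] S'M HS'.
exact: min_traces_min S'M HX HS'.
Qed.

Variable m : I -> I -> {set V} -> nat.
Hypothesis lexm : lex_weight f B m.

Definition lightest i j K : Prop :=
  K \in crossing i j /\
  forall L, L \in crossing i j -> L :&: adh i j = K :&: adh i j -> m i j K <= m i j L.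

Lemma lightest_exists i j S : S \in min_traces i j ->
  exists2 H, lightest i j H & H :&: adh i j = S.
Proof.
case/min_traces_crossing=> H0 H0X H0S.
pose P H := (H \in crossing i j) && (H :&: adh i j == S).
have P0 : P H0 by rewrite /P H0X H0S eqxx.
have [H /andP[HX /eqP HS] Hmin] := arg_minnP (m i j) P0.
by exists H => //; split=> // L LX LE; apply: Hmin; rewrite /P LX LE HS eqxx.
Qed.

(** Apply [one_sided] to [L] against [H], [K] against [H] and [L] against [K]. The only case not
    settled at once has [L] inside both [H] and [K] beyond [i -> j]: either [K] is inside [L] there,
    so [x] is in [H], or [L] is lighter than [K]. *)
Lemma hit_pair i j K L H x y : f i j ->
    lightest i j K -> L \in crossing i j -> L :&: adh i j = K :&: adh i j ->
    H \in F -> sub_on (adh i j) K H ->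
    x \in K -> x \in D i j -> y \in L -> y \in D j i ->
  x \in H \/ y \in H.
Proof.
move=> ij [KX Kmin] LX LK HF KH xK xij yL yji.
have [[KF _ _ _] [LF _ _ _]] := (crossingP _ _ _ KX, crossingP _ _ _ LX).
have LK' : sub_on (adh i j) L K by rewrite /sub_on LK subsetIl.
have LH : sub_on (adh i j) L H by rewrite /sub_on LK.
case: (one_sided ij HF LF LH) => /sub_onP LsubH; last by right; apply: LsubH.
case: (one_sided ij HF KF KH) => /sub_onP KsubH; first by left; apply: KsubH.
case: (one_sided ij KF LF LK') => LsubK; last first.
  by right; apply: KsubH => //; move/sub_onP: LsubK; apply.
case: (boolP (sub_on (D i j) K L)) => [/sub_onP KsubL|KnL].
  by left; apply: LsubH => //; apply: KsubL.
have [/(_ LsubK KnL) lt _ _] := lexm ij L K.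
by move: (Kmin L LX LK); rewrite leqNgt lt.
Qed.

(** Requiring a hub to lie in [B j] or to be a hub of an edge leaving [j] is what will keep the
    enlarged bags of a vertex connected. *)
Definition hub_set (P : I -> I -> {set V}) i j (X : {set V}) : Prop :=
  [/\ forall x, x \in X -> [/\ x \in D i j, c x &
        x \in B j \/ exists k, [/\ f j k, k != i & x \in P j k]],
      #|X| <= 2 ^ t &
      forall S, S \in min_traces i j -> exists K x,
        [/\ lightest i j K, K :&: adh i j = S, x \in K & x \in X]].

(** * A hub for a minimal trace, given the hubs further out *)

Section Step.

Variables (P : I -> I -> {set V}) (i j : I).
Hypothesis ij : f i j.
Hypothesis hubP : forall k, f j k -> k != i -> hub_set P j k (P j k).

Let hub_of k H : f j k -> k != i -> H \in crossing j k ->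
  exists K x, [/\ lightest j k K, sub_on (adh j k) K H, x \in K & x \in P j k].
Proof.
move=> jk ki /min_traces_exists[S SM SH].
have [_ _ /(_ S SM)[K [x [Kl KS xK xP]]]] := hubP jk ki.
by exists K, x; split=> //; rewrite /sub_on KS.
Qed.

Variables (S : {set V}) (H : {set V}).
Hypotheses (SM : S \in min_traces i j) (HS : H :&: adh i j = S) (Hl : lightest i j H).

(** [K] ranges over all lightest sets of trace [S], since the contradiction may come from a stray
    that ties with [H]. *)
Definition hubbed : Prop := exists K x,
  [/\ lightest i j K, K :&: adh i j = S, x \in K, x \in D i j & c x] /\
  (x \in B j \/ exists k, [/\ f j k, k != i & x \in P j k]).

Hypothesis not_hubbed : ~ hubbed.

Let HX : H \in crossing i j. Proof. by case: Hl. Qed.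
Let HF : H \in F. Proof. by case/crossingP: HX. Qed.
Let ji : f j i. Proof. by rewrite f_sym. Qed.

Let hubD k x : f j k -> k != i -> x \in P j k -> [/\ x \in D j k, x \in D i j & c x].
Proof.
move=> jk ki xP; have [/(_ x xP)[xk cx _] _ _] := hubP jk ki.
by split=> //; apply: (beyond_sub decB) jk ki xk.
Qed.

Let hub_notin k x : f j k -> k != i -> x \in P j k -> x \notin H.
Proof.
move=> jk ki xP; apply/negP => xH; apply: not_hubbed; exists H, x.
by have [_ xij cx] := hubD jk ki xP; split; [|right; exists k].
Qed.

Let H_red v : v \in H -> v \in B j -> c v = false.
Proof.
move=> vH vj; have [vi|vi] := boolP (v \in B i).
  by case/crossingP: HX => _ _ _ /blue_onPn; apply; rewrite // in_setI vi.
apply/negP => cv; apply: not_hubbed; exists H, v; split; last by left.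
by split=> //; apply: (bag_beyond decB).
Qed.

(* The hub [x] of [K] towards [k] is then outside [H], by [hub_notin]. *)
Let stray k K x := [/\ f j k, k != i, lightest j k K & x \in K] /\
  [/\ x \in P j k, sub_on (B j) K H, sub_on (D k j) K H & blue_on H (D j k)].

Let H_crossing k : f j k -> k != i -> blue_on H (D j k) -> H \in crossing j k.
Proof.
move=> jk ki Hk; apply/crossingP; split=> //.
  case/crossingP: HX => _ _ /blue_onP[v [vH vji cv]] _; apply/blue_onP; exists v; split=> //.
  by apply: (beyond_back decB) ji jk _ vji; rewrite eq_sym.
apply/blue_onP => -[v [vH]]; rewrite in_setI => /andP[vj _].
by rewrite H_red.
Qed.

(** The hub [x] is outside [L], because [L] is inside [H] beyond [j -> k]. So by [one_sided], [K]
    lies in [L] on the other side, which together with the adhesion covers [B j]. *)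
Let stray_of k K x L : f j k -> k != i -> lightest j k K -> x \in K -> x \in P j k ->
  sub_on (adh j k) K L -> sub_on (D j k) L H -> L \in F -> 
  sub_on (B j) K L /\ sub_on (D k j) K L.
Proof.
move=> jk ki Kl xK xP KL LH LF; have [KX _] := Kl; have [KF _ _ _] := crossingP _ _ _ KX.
have [xk _ _] := hubD jk ki xP; have xH := hub_notin jk ki xP.
case: (one_sided jk LF KF KL) => /sub_onP KsubL.
  case/negP: xH; move/sub_onP: LH; apply=> //; exact: KsubL.
split; apply/sub_onP => // v vj vK.
case: (beyond_total decB v jk) => [vadh|/beyond_notin|vkj]; last exact: KsubL.
  by move/sub_onP: KL; apply.
by rewrite vj.
Qed.

(** Descent on the trace of [K] on [B j]. If [K] has blue vertices beyond [j -> i], it competes with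
    [H] at the edge [i -> j]; if not, it reaches into another branch [k2], whose hubs yield a
    smaller stray or a contradiction. *)
Let stray_false n k K x : #|K :&: B j| < n -> stray k K x -> False.
Proof.
elim: n k K x => // n IHn k K x; rewrite ltnS => leKn.
case=> -[jk ki Kl xK] [xP /sub_onP KB KU Hk].
have [KX Kmin] := Kl; have [KF Kk Kkj _] := crossingP _ _ _ KX.
have [xk xij cx] := hubD jk ki xP; have xH := hub_notin jk ki xP.
have K_red v : v \in K -> v \in B j -> c v = false.
  by move=> vK vj; apply: H_red => //; apply: KB.
have KS : K :&: adh i j \subset S.
  apply/subsetP => v; rewrite -HS !in_setI => /and3P[vK vi vj].
  by rewrite vi vj KB.
case: (boolP (blue_on K (D j i))) => [Kji|Kji].
  have KXij : K \in crossing i j.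
    apply/crossingP; split=> //; first by apply/blue_onP; exists x.
    apply/blue_onP => -[v [vK]]; rewrite in_setI => /andP[_ vj].
    by rewrite K_red.
  have KSE := min_traces_min SM KXij KS.
  have KHE : K :&: adh i j = H :&: adh i j by rewrite KSE HS.
  (* The traces on the adhesion agree, so a vertex of [H] in [B j] missing from [K] lies in the
     first layer and makes [K] lighter than [H]. *)
  case: (boolP (sub_on (B j) H K)) => [/sub_onP HB|/sub_onPn[v [vj vH vK]]]; last first.
    have [_ lt _] := lexm ij K H.
    have [_ Hmin] := Hl; move: (Hmin K KXij KHE); rewrite leqNgt => /negP[].
    apply: lt; first by apply/sub_onP => w; rewrite in_setD => /andP[_]; apply: KB.
    apply/sub_onPn; exists v; split=> //; rewrite in_setD vj andbT; apply/negP => vi.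
    by case/negP: vK; move/setP/(_ v): KHE; rewrite !in_setI vi vj vH !andbT => ->.
  have HKadh : H :&: adh j k = K :&: adh j k.
    apply/setP => v; rewrite !in_setI; case vj: (v \in B j); rewrite ?andbF //=.
    by congr andb; apply/idP/idP; [exact: HB | exact: KB].
  have HXk := H_crossing jk ki Hk.
  have HKs : sub_on (adh j k) H K by rewrite /sub_on HKadh subsetIl.
  (* If [H] is inside [K] beyond [j -> k], it is lighter there, as it misses [x]. Otherwise [H] and
     [K] agree outside this branch, so [K] is lightest for [i -> j] too and [x] is a valid hub. *)
  case: (one_sided jk KF HF HKs) => HK.
    have [/(_ HK) lt _ _] := lexm jk H K.
    move: (Kmin H HXk HKadh); rewrite leqNgt lt //.
    by apply/sub_onPn; exists x.
  apply: not_hubbed; exists K, x; split; last by right; exists k.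
  split=> //; split=> // L LX LE; apply: leq_trans (_ : m i j H <= _); last first.
    by case: Hl => _; apply=> //; rewrite LE KSE HS.
  have [_ _ /(_ k jk ki)] := lexm ij K H; apply; last exact: Kmin.
  apply/setP => v; rewrite !in_setD; case: (boolP (v \in D j k)) => //= vk.
  case: (beyond_total decB v jk) => [vadh|vk'|vkj]; last 2 first.
  - by rewrite vk' in vk.
  - by apply/idP/idP; [move/sub_onP: KU; apply | move/sub_onP: HK; apply].
  move: vadh; rewrite in_setI => /andP[vj vk'].
  by move/setP/(_ v): HKadh; rewrite !in_setI vj vk' !andbT.
(* Without blue beyond [j -> i] or in [B j], the blue vertices of [K] outside the branch [k] lie in
   a third branch, which [K] therefore crosses. *)
have [v [vK vkj cv]] := blue_onP _ _ Kkj.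
have vj : v \notin B j by apply/negP => /K_red; rewrite cv => /(_ vK).
have [k2 jk2 vk2] := beyond_cover decB vj.
have k2i : k2 != i.
  by apply/eqP => E; case/blue_onP: Kji; exists v; rewrite -E.
have kk2 : k != k2.
  by apply/eqP => E; rewrite -E in vk2; apply: (beyond_disjoint decB jk vk2 vkj).
have KX2 : K \in crossing j k2.
  apply/crossingP; split=> //; first by apply/blue_onP; exists v.
    by apply/blue_onP; exists x; split=> //; apply: (beyond_back decB) jk jk2 kk2 xk.
  by apply/blue_onP => -[w [wK]]; rewrite in_setI => /andP[wj _]; rewrite K_red.
have [K2 [x2 [K2l K2K x2K2 x2P]]] := hub_of jk2 k2i KX2.
have [x2k _ _] := hubD jk2 k2i x2P; have x2H := hub_notin jk2 k2i x2P.
have KH2 : sub_on (D j k2) K H.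
  apply/sub_onP => w wk2; move/sub_onP: KU; apply.
  by apply: (beyond_back decB) jk2 jk _ wk2; rewrite eq_sym.
have KHadh : sub_on (adh j k2) K H.
  by apply/sub_onP => w; rewrite in_setI => /andP[wj _]; apply: KB.
have K2Hadh : sub_on (adh j k2) K2 H.
  apply/sub_onP => w wA wK2; move/sub_onP: KHadh; apply=> //.
  by move/sub_onP: K2K; apply.
have [K2BK K2UK] := stray_of jk2 k2i K2l x2K2 x2P K2K KH2 KF.
have HHD : sub_on (D j k2) H H by apply/sub_onP.
have [K2BH K2UH] := stray_of jk2 k2i K2l x2K2 x2P K2Hadh HHD HF.
(* If [K2] has a smaller trace on [B j], it is a stray for the induction. If the traces agree,
   [hit_pair] at [j -> k2] puts [x2] or [x] into [H]. *)
have [BE|BN] := boolP (sub_on (B j) K K2); last first.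
  apply: (IHn k2 K2 x2).
    apply: leq_trans leKn; apply: proper_card; rewrite properE !subsetI !subsetIr !andbT.
    exact/andP.
  split; split=> //; apply/blue_onP; exists v; split=> //.
  by move/sub_onP: KH2; apply.
have KE : K :&: adh j k2 = K2 :&: adh j k2.
  apply/setP => w; rewrite !in_setI; case wj: (w \in B j); rewrite ?andbF //=.
  congr andb; apply/idP/idP; first by move/sub_onP: BE; apply.
  by move/sub_onP: K2BK; apply.
have xk2j : x \in D k2 j by apply: (beyond_back decB) jk jk2 kk2 xk.
case: (hit_pair jk2 K2l KX2 KE HF K2Hadh x2K2 x2k xK xk2j); apply/negP => //.
Qed.

(** Having no blue vertex in [B j], [H] is blue beyond some [j -> k] and crosses that edge; the hub
    found there gives a first stray. *)
Lemma not_hubbed_false : False.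
Proof.
have [_ /blue_onP[v [vH vij cv]] _ _] := crossingP _ _ _ HX.
have vj : v \notin B j by apply/negP => vj; move: cv; rewrite H_red.
have [k jk vk] := beyond_cover decB vj.
have ki : k != i.
  by apply/eqP => E; rewrite E in vk; apply: (beyond_disjoint decB ij vij vk).
have Hk : blue_on H (D j k) by apply/blue_onP; exists v.
have [K [x [Kl KH xK xP]]] := hub_of jk ki (H_crossing jk ki Hk).
have HHD : sub_on (D j k) H H by apply/sub_onP.
have [KB KU] := stray_of jk ki Kl xK xP KH HHD HF.
exact: (@stray_false #|K :&: B j|.+1 k K x).
Qed.

End Step.

Lemma hubbed_min_trace P i j S : f i j ->
    (forall k, f j k -> k != i -> hub_set P j k (P j k)) ->
  S \in min_traces i j -> hubbed P i j S.
Proof.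
move=> ij hubP SM; have [H Hl HS] := lightest_exists SM.
(* [not_hubbed_false] only refutes the negation of [hubbed]; boolean versions of the predicates make
   it decidable. *)
pose light K := (K \in crossing i j) &&
  [forall (L | L \in crossing i j), (L :&: adh i j == K :&: adh i j) ==> (m i j K <= m i j L)].
have lightP K : reflect (lightest i j K) (light K).
  apply: (iffP andP) => -[KX Kmin]; split=> //.
    by move=> L LX /eqP LE; move/forallP/(_ L): Kmin; rewrite LX LE.
  by apply/forallP => L; apply/implyP => LX; apply/implyP => /eqP; apply: Kmin.
pose passed x := (x \in B j) || [exists k, [&& f j k, k != i & x \in P j k]].
have passedP x :
    reflect (x \in B j \/ exists k, [/\ f j k, k != i & x \in P j k]) (passed x).
  apply: (iffP orP) => -[xj|]; [by left| |by left|].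
    by case/existsP=> k /and3P[jk ki xk]; right; exists k.
  by case=> k [jk ki xk]; right; apply/existsP; exists k; rewrite jk ki.
case: (boolP [exists K : {set V}, exists x, [&& light K, K :&: adh i j == S, x \in K,
    x \in D i j, c x & passed x]]) => [|N].
  case/existsP=> K /existsP[x /and5P[/lightP Kl /eqP KS xK xij /andP[cx /passedP px]]].
  by exists K, x.
case: (not_hubbed_false ij hubP SM HS Hl) => -[K [x [[/lightP Kl KS xK xij cx] /passedP px]]].
case/existsP: N; exists K; apply/existsP; exists x.
by rewrite Kl KS eqxx xK xij cx.
Qed.

Lemma hubs_exist : exists P, forall i j, f i j -> hub_set P i j (P i j).
Proof.
apply: (edge_recursion treef set0).
  move=> P P' i j X PP' [X1 X2 X3]; split=> // x /X1[xij cx px]; split=> //.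
  by case: px => [|[k [jk ki xk]]]; [left | right; exists k; rewrite -PP'].
move=> P i j ij hubP.
have /fin_all_exists[h hP] (s : {S | S \in min_traces i j}) : exists x : V,
    [/\ x \in D i j, c x, x \in B j \/ exists k, [/\ f j k, k != i & x \in P j k] &
        exists K, [/\ lightest i j K, K :&: adh i j = val s & x \in K]].
  have [K [x [[Kl KS xK xij cx] px]]] := hubbed_min_trace ij hubP (valP s).
  by exists x; split=> //; exists K.
exists (h @: setT); split.
- by move=> _ /imsetP[s _ ->]; have [] := hP s.
- apply: leq_trans (leq_imset_card _ _) _.
  by rewrite cardsT card_sig; apply: card_min_traces.
move=> S SM; have [_ _ _ [K [Kl KS xK]]] := hP (Sub S SM).
by exists K, (h (Sub S SM)); split=> //; apply: imset_f.
Qed.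

(** A minimal trace inside [H] has one hub in each orientation, and [hit_pair] places one of the two
    in [H]. *)
Lemma hubs_hit P i j H : f i j -> (forall i j, f i j -> hub_set P i j (P i j)) ->
  H \in crossing i j -> exists2 x, x \in H & x \in P i j :|: P j i.
Proof.
move=> ij hubP HX; have ji : f j i by rewrite f_sym.
have [HF _ _ _] := crossingP _ _ _ HX; have [S SM SH] := min_traces_exists HX.
have [Pij _ /(_ S SM)[K [x [Kl KS xK xP]]]] := hubP i j ij.
have [Pji _ hji] := hubP j i ji.
have SM' := SM; rewrite min_tracesC in SM'.
have [L [y [[LX _] LS yL yP]]] := hji S SM'.
rewrite crossingC in LX; rewrite [B j :&: B i]setIC in LS.
have KH : sub_on (adh i j) K H by rewrite /sub_on KS.
have [xij _ _] := Pij x xP; have [yji _ _] := Pji y yP.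
have LK : L :&: adh i j = K :&: adh i j by rewrite KS.
case: (hit_pair ij Kl LX LK HF KH xK xij yL yji) => hit; [exists x | exists y] => //.
  by rewrite in_setU xP.
by rewrite in_setU yP orbT.
Qed.

End Hubs.

(** * The support *)

Section Support.

Variables (V : finType) (e : rel V) (I : finType) (f : rel I) (B : I -> {set V}).
Variables (c : V -> bool) (F : {set {set V}}) (t d : nat).
Hypothesis decB : tree_decomposition e f B.
Hypothesis npF : non_piercing e F.
Hypothesis cardB : forall i, #|B i| <= t.+1.
Hypothesis degf : forall i, #|[set j | f i j]| <= d.

Let treef : is_tree f. Proof. by case: decB. Qed.
Let f_sym : symmetric f. Proof. by case: treef => -[]. Qed.

Variables (m : I -> I -> {set V} -> nat) (P : I -> I -> {set V}).
Hypothesis lexm : lex_weight f B m.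
Hypothesis hubP : forall i j, f i j -> hub_set f B c F t m P i j (P i j).

(** Adding the hubs of leaving edges is enough: a hub of an edge entering [i] lies in [B i] or is a
    hub of an edge leaving [i]. *)
Definition hub_bag i : {set V} :=
  [set v | c v && ((v \in B i) || [exists j, f i j && (v \in P i j)])].

Lemma bag_hub_bag i v : c v -> v \in B i -> v \in hub_bag i.
Proof. by rewrite inE => -> ->. Qed.

Lemma hub_hub_bag i j v : f i j -> v \in P i j -> v \in hub_bag i /\ v \in hub_bag j.
Proof.
move=> ij vP; have [/(_ v vP)[_ cv pv] _ _] := hubP ij.
split; rewrite inE cv; first by apply/orP; right; apply/existsP; exists j; rewrite ij.
case: pv => [-> //|[k [jk _ vk]]].
by apply/orP; right; apply/existsP; exists k; rewrite jk.
Qed.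

Lemma card_hub_bag i : #|hub_bag i| <= t.+1 + d * 2 ^ t.
Proof.
have sub : hub_bag i \subset B i :|: \bigcup_(j in [set j | f i j]) P i j.
  apply/subsetP => v; rewrite inE => /andP[_ /orP[vi|/existsP[j /andP[ij vj]]]].
    by rewrite inE vi.
  by rewrite inE; apply/orP; right; apply/bigcupP; exists j; rewrite ?inE.
apply: leq_trans (subset_leq_card sub) _.
apply: leq_trans (leq_card_setU _ _) _; apply: leq_add => //.
apply: leq_trans (_ : \sum_(j in [set j | f i j]) 2 ^ t <= _); last first.
  by rewrite sum_nat_const leq_mul2r degf orbT.
elim/big_rec2: _ => [|j n X]; first by rewrite cards0.
rewrite inE => ij le; apply: leq_trans (leq_card_setU _ _) _; apply: leq_add => //.
by have [] := hubP ij.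
Qed.

(** A hub is passed outwards from edge to edge until it lies in an original bag, and every node on
    the way has it in its hub bag. *)
Lemma hub_bag_home i v : v \in hub_bag i ->
  exists2 l, v \in B l & connect (induced f [set i | v \in hub_bag i]) i l.
Proof.
have via : forall i j, f i j -> forall v, v \in P i j ->
    exists2 l, v \in B l & connect (induced f [set i | v \in hub_bag i]) i l.
  apply: (edge_ind treef) => {}i j ij IH {}v vP.
  have [vi vj] := hub_hub_bag ij vP.
  have i1j : connect (induced f [set i | v \in hub_bag i]) i j.
    by apply: connect1; apply/and3P; split; rewrite // in_set.
  have [/(_ v vP)[_ _ pv] _ _] := hubP ij.
  case: pv => [vBj|[k [jk ki vk]]]; first by exists j.
  have [l vl jl] := IH k jk ki v vk; exists l => //.
  exact: connect_trans i1j jl.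
rewrite inE => /andP[_ /orP[vi|/existsP[j /andP[ij vj]]]]; first by exists i.
exact: via ij v vj.
Qed.

Lemma hub_bag_connected v : connected_in f [set i | v \in hub_bag i].
Proof.
move=> i j; rewrite in_set => vi; rewrite in_set => vj.
have cv : c v by move: vi; rewrite inE => /andP[].
have csym := sym_connect_sym (induced_sym [set i | v \in hub_bag i] f_sym).
have [l vl il] := hub_bag_home vi; have [l' vl' jl'] := hub_bag_home vj.
apply: connect_trans il _; rewrite csym; apply: connect_trans jl' _.
case: decB => _ _ _ /(_ v l' l); rewrite !in_set => /(_ vl' vl).
apply: connect_sub => a b; rewrite /induced /= !in_set => /and3P[va vb ab].
by apply: connect1; apply/and3P; split; rewrite // in_set bag_hub_bag.
Qed.

(** Either a blue vertex of [H] in the adhesion serves, or [H] crosses and contains a hub. The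
    places of [x] and [y] are given by bags because either may lie in the adhesion. *)
Lemma hub_bag_crossing i j i0 k H x y :
    f i j -> H \in F -> x \in H -> y \in H -> c x -> c y ->
    x \in B i0 -> i0 \in side f j i -> y \in B k -> k \in side f i j ->
  exists z, [/\ z \in H, z \in hub_bag i & z \in hub_bag j].
Proof.
move=> ij HF xH yH cx cy xi0 i0s yk ks; have ji : f j i by rewrite f_sym.
case: (boolP (blue_on c H (B i :&: B j))) => [/blue_onP[z [zH]]|red].
  by rewrite in_setI => /andP[zi zj] cz; exists z; rewrite !bag_hub_bag.
have xji : x \in beyond f B j i.
  case: (beyond_total decB x ij) => // [xA|xij]; first by rewrite (blue_onPn red xH xA) in cx.
  by case: (side_disjoint treef ij (beyond_bags decB ij xij xi0) i0s).
have yij : y \in beyond f B i j.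
  case: (beyond_total decB y ij) => // [yA|yji]; first by rewrite (blue_onPn red yH yA) in cy.
  by case: (side_disjoint treef ij ks (beyond_bags decB ji yji yk)).
have HX : H \in crossing f B c F i j.
  by apply/crossingP; split=> //; apply/blue_onP; [exists y | exists x].
have [z zH] := hubs_hit decB npF lexm ij hubP HX.
by rewrite in_setU => /orP[] /hub_hub_bag[] // zi zj; exists z.
Qed.

Definition hub_graph : rel {v : V | c v} :=
  [rel x y | (x != y) && [exists i, (val x \in hub_bag i) && (val y \in hub_bag i)]].

Lemma hub_graph_connect (S : {set {v : V | c v}}) i x y :
  x \in S -> y \in S -> val x \in hub_bag i -> val y \in hub_bag i ->
  connect (induced hub_graph S) x y.
Proof.
move=> xS yS xi yi; have [->|xy] := eqVneq x y; first exact: connect0.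
apply: connect1; apply/and3P; split=> //; apply/andP; split=> //.
by apply/existsP; exists i; rewrite xi.
Qed.

Lemma side_path i j x p : f i j -> x \in side f i j -> path f x p -> i \notin p ->
  last x p \in side f i j.
Proof.
move=> ij; elim: p x => //= y p IHp x xs /andP[xy yp]; rewrite inE negb_or => /andP[iy ip].
apply: IHp => //; apply: (side_step treef) xs xy (tree_edge_neq treef ij) _.
by rewrite eq_sym.
Qed.

Lemma hub_graph_support : primal_support F hub_graph.
Proof.
split.
  split=> [x y|x]; last by rewrite /hub_graph /= eqxx.
  rewrite /hub_graph /= eq_sym; congr andb.
  by apply/existsP/existsP => -[i]; rewrite andbC; exists i.
move=> H HF x y; rewrite !in_set => xH yH.
have [_ cov _ _] := decB; have [i0 xi0] := cov (val x); have [k yk] := cov (val y).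
have [_ _ conn _] := treef.
have /connectP[p0 pp0 lp0] := conn i0 k (in_setT _) (in_setT _).
move: lp0; have [p pp up _] := shortenP pp0 => {p0 pp0} lp.
have {}pp : path f i0 p by apply: sub_path pp => a b /and3P[].
pose S := [set z : {v : V | c v} | val z \in H].
have inS z : val z \in H -> z \in S by rewrite in_set.
(* Follow the tree path from a bag of [x] to a bag of [y], holding a vertex [z] of [H] in the
   current hub bag. The last condition keeps [x] behind the next edge. *)
have walk : forall q i (z : {v : V | c v}), path f i q -> uniq (i :: q) -> k = last i q ->
    val z \in H -> val z \in hub_bag i ->
    (forall j, ohead q = Some j -> i0 \in side f j i) ->
    connect (induced hub_graph S) z y.
  elim=> [|j q IHq] i z /=.
    move=> _ _ ki /inS zS zi _; apply: (hub_graph_connect zS (inS y yH) zi).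
    by rewrite bag_hub_bag -?ki // (valP y).
  case/andP=> ij jp /andP[ip ujp] kl zH zi i0s.
  have i0j : i0 \in side f j i by apply: i0s.
  have ks : k \in side f i j.
    rewrite kl; apply: side_path; rewrite ?side_self //.
    by move: ip; rewrite inE negb_or => /andP[].
  have [w [wH wi wj]] := hub_bag_crossing ij HF xH yH (valP x) (valP y) xi0 i0j yk ks.
  have cw : c w by move: wi; rewrite inE => /andP[].
  apply: connect_trans (IHq j (Sub w cw) jp ujp kl wH wj _).
    exact: (@hub_graph_connect S i z (Sub w cw) (inS z zH) (inS (Sub w cw) wH) zi wi).
  move=> l lp'; have jl : f j l by case: (q) jp lp' => //= a s /andP[ja _] [<-].
  have li : i != l.
    apply: contraNneq ip => ->; rewrite inE; apply/orP; right.
    by case: (q) lp' => //= a s [->]; rewrite mem_head.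
  apply: subsetP i0j; apply: side_sub => //; by rewrite f_sym.
apply: (walk p i0) => //; first by rewrite bag_hub_bag // (valP x).
by move=> j _; apply: side_self.
Qed.

Lemma hub_graph_tw : tw_le hub_graph (t + d * 2 ^ t).
Proof.
exists I, f, (fun i => [set x : {v : V | c v} | val x \in hub_bag i]); split.
  split=> //.
  - move=> x; case: decB => _ /(_ (val x))[i xi] _ _; exists i.
    by rewrite in_set bag_hub_bag // (valP x).
  - move=> x y /andP[_ /existsP[i /andP[xi yi]]]; exists i.
    by apply/andP; split; rewrite in_set.
  - move=> x; rewrite (_ : [set i | _] = [set i | val x \in hub_bag i]).
      exact: hub_bag_connected.
    by apply/setP => i; rewrite [LHS]in_set [LHS]in_set [RHS]in_set.
move=> i; rewrite -addSn; apply: leq_trans (card_hub_bag i).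
rewrite -(card_imset _ val_inj); apply: subset_leq_card.
by apply/subsetP => _ /imsetP[x + ->]; rewrite in_set.
Qed.

End Support.

Theorem mainTheorem1 (V : finType) (e : rel V) (c : V -> bool)
  (F : {set {set V}}) (t : nat) :
  simple_graph e -> treewidth e t -> non_piercing e F ->
  exists Q : rel {v : V | c v},
    @primal_support V c F Q /\ tw_le Q (2 ^ (t + 2) + t).
Proof.
move=> _ [[I [f [B [decB cardB]]]] _] npF.
have [J [f' [p [decB' deg3]]]] := subcubic_decomposition decB.
have cardB' x : #|(B \o p) x| <= t.+1 by apply: cardB.
have [m lexm] := lex_weight_exists decB'.
have [P hubP] := hubs_exist c decB' npF cardB' lexm.
exists (hub_graph (c := c) f' (B \o p) P); split.
  exact (hub_graph_support decB' npF lexm hubP).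
have [J' [g [B' [decQ cardQ]]]] := hub_graph_tw decB' cardB' deg3 hubP.
exists J', g, B'; split=> // i; apply: leq_trans (cardQ i) _.
(* With degree at most 3, it remains that [3 * 2 ^ t <= 2 ^ (t + 2)]. *)
by rewrite ltnS addnC leq_add2r addn2 !expnS mulnA leq_mul2r orbT.
Qed.
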